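(* There is an algorithm which, given a distance function $d$ on $\{1,\dots,n\}$, decides whether $d\in HYP_n$; and there is an algorithm which, given a distance function $d$ on $\{1,\dots,n\}$, decides whether $d\in HYPP_n$.
   Context: A distance function $d:\{1,\dots,n\}^2\to\mathbb{R}$ is symmetric with $d(i,i)=0$, and is identified with a vector $(d(i,j))_{1\le i<j\le n}\in\mathbb{R}^{\binom n2}$. The hypermetric cone $HYP_n$ is the set of all such $d$ satisfying the infinitely many inequalities $$\sum_{1\le i<j\le n} b_i b_j\, d(i,j)\le 0\quad\text{for all } b\in\mathbb{Z}^n \text{ with } \sum_{i=1}^n b_i=1.$$ The hypermetric polytope $HYPP_n$ is the set of all such $d$ satisfying the infinitely many inequalities $$\sum_{1\le i<j\le n} b_i b_j\, d(i,j)\le s(s+1)\quad\text{for all } b\in\mathbb{Z}^n \text{ and } s\in\mathbb{Z} \text{ with } \sum_{i=1}^n b_i=2s+1.$$ *)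

(* Defs.v *)
From HB Require Import structures.
From mathcomp Require Import all_boot all_order all_algebra.
From mathcomp Require Import reals.

Set Implicit Arguments.
Unset Strict Implicit.
Unset Printing Implicit Defensive.

Import Order.TTheory GRing.Theory Num.Theory.
Local Open Scope ring_scope.

Section Hypermetric.
Variables (R : realType) (n : nat).
Implicit Types d : 'I_n -> 'I_n -> R.

Definition is_distance d : Prop :=
  (forall i j, d i j = d j i) /\ (forall i, d i i = 0).

Definition hyp_form (b : 'I_n -> int) d : R :=
  \sum_(i < n) \sum_(j < n | (i < j)%N) (b i)%:~R * (b j)%:~R * d i j.

Definition HYP d : Prop :=
  is_distance d /\
  forall b : 'I_n -> int, \sum_(i < n) b i = 1 -> hyp_form b d <= 0.

Definition HYPP d : Prop :=
  is_distance d /\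
  forall (b : 'I_n -> int) (s : int), \sum_(i < n) b i = 2 * s + 1 ->
    hyp_form b d <= (s * (s + 1))%:~R.

End Hypermetric.

(* Algorithms on real data are programs for a real RAM (the uniform
   Blum-Shub-Smale model): an integer memory and a real memory, both unbounded
   and indirectly addressed, exact field operations and comparisons on reals,
   and while-loops.  The syntax does not mention [R]: a program has no real
   constants beyond those it can compute from natural numbers, and there is no
   rounding operation from reals to integers.  Hence the restriction of a
   program to rational inputs is an algorithm in the sense of Turing. *)

Inductive nexp : Type :=
| NConst of nat
| NGet of nexp (* content of the integer cell at the given address *)
| NAdd of nexp & nexp
| NSub of nexp & nexp
| NMul of nexp & nexp
| NDiv of nexp & nexp
| NMod of nexp & nexp.

Inductive rexp : Type :=
| RNat of nexp
| RGet of nexp (* content of the real cell at the given address *)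
| RAdd of rexp & rexp
| RSub of rexp & rexp
| RMul of rexp & rexp
| RDiv of rexp & rexp.

Inductive bexp : Type :=
| NLe of nexp & nexp
| RLe of rexp & rexp
| BNot of bexp
| BAnd of bexp & bexp.

Inductive cmd : Type :=
| Skip
| NSet of nexp & nexp (* NSet a e : integer cell at address a := e *)
| RSet of nexp & rexp (* RSet a e : real cell at address a := e *)
| Seq of cmd & cmd
| If of bexp & cmd & cmd
| While of bexp & cmd.

Section Semantics.
Variable R : realType.

Record state : Type := State { nmem : nat -> nat; rmem : nat -> R }.

Definition update (T : Type) (m : nat -> T) (a : nat) (v : T) : nat -> T :=
  fun k => if k == a then v else m k.

(* Truncated subtraction, and the library's conventions for division by 0. *)
Fixpoint neval (st : state) (e : nexp) : nat :=
  match e with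
  | NConst k => k
  | NGet a => nmem st (neval st a)
  | NAdd e1 e2 => neval st e1 + neval st e2
  | NSub e1 e2 => neval st e1 - neval st e2
  | NMul e1 e2 => neval st e1 * neval st e2
  | NDiv e1 e2 => neval st e1 %/ neval st e2
  | NMod e1 e2 => neval st e1 %% neval st e2
  end%N.

Fixpoint reval (st : state) (e : rexp) : R :=
  match e with
  | RNat a => (neval st a)%:R
  | RGet a => rmem st (neval st a)
  | RAdd e1 e2 => reval st e1 + reval st e2
  | RSub e1 e2 => reval st e1 - reval st e2
  | RMul e1 e2 => reval st e1 * reval st e2
  | RDiv e1 e2 => reval st e1 / reval st e2
  end.

Fixpoint beval (st : state) (c : bexp) : bool :=
  match c with
  | NLe e1 e2 => (neval st e1 <= neval st e2)%N
  | RLe e1 e2 => reval st e1 <= reval st e2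
  | BNot c1 => ~~ beval st c1
  | BAnd c1 c2 => beval st c1 && beval st c2
  end.

(* [exec p st st'] : started in [st], the program [p] halts in [st']. *)
Inductive exec : cmd -> state -> state -> Prop :=
| exec_skip st : exec Skip st st
| exec_nset a e st :
    exec (NSet a e) st
      (State (update (nmem st) (neval st a) (neval st e)) (rmem st))
| exec_rset a e st :
    exec (RSet a e) st
      (State (nmem st) (update (rmem st) (neval st a) (reval st e)))
| exec_seq p q st1 st2 st3 :
    exec p st1 st2 -> exec q st2 st3 -> exec (Seq p q) st1 st3
| exec_if c p q st st' :
    exec (if beval st c then p else q) st st' -> exec (If c p q) st st'
| exec_while_end c p st : ~~ beval st c -> exec (While c p) st st
| exec_while_loop c p st1 st2 st3 :
    beval st1 c -> exec p st1 st2 -> exec (While c p) st2 st3 ->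
    exec (While c p) st1 st3.

Lemma exec_det p st st1 st2 : exec p st st1 -> exec p st st2 -> st1 = st2.
Proof.
move=> E; elim: E st2 => {p st st1}.
- by move=> st st2 H; inversion H.
- by move=> a e st st2 H; inversion H.
- by move=> a e st st2 H; inversion H.
- move=> p q s1 s2 s3 _ IHp _ IHq st H.
  by inversion H as [| | |? ? ? s ? Hp Hq| | |]; subst; apply/IHq; rewrite (IHp s).
- by move=> c p q st st' _ IH st2 H; inversion H; subst; apply: IH.
- move=> c p s Nc st H.
  by inversion H as [| | | | | |? ? ? ? ? Hc]; subst => //; rewrite Hc in Nc.
- move=> c p s1 s2 s3 Hc _ IHp _ IHw st H.
  inversion H as [| | | | |? ? ? Nc|? ? ? s ? _ Hp Hw]; subst.
    by rewrite Hc in Nc.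
  by apply: IHw; rewrite (IHp s).
Qed.

(* Input convention: n is in integer cell 0 and d(i,j), for 0 <= i, j < n, is in
   real cell i * n + j; all the other cells are 0. *)
Definition input (n : nat) (d : 'I_n -> 'I_n -> R) : state :=
  State (update (fun=> 0%N) 0 n)
        (fun k => match insub (k %/ n)%N, insub (k %% n)%N with
                  | Some i, Some j => d i j
                  | _, _ => 0
                  end).

Lemma input_rmem n (d : 'I_n -> 'I_n -> R) (i j : 'I_n) :
  rmem (input d) (i * n + j) = d i j.
Proof.
have n_gt0 : (0 < n)%N by apply: leq_ltn_trans (ltn_ord i).
by rewrite /= divnMDl // divn_small // addn0 modnMDl modn_small // !valK.
Qed.

(* One program must serve all n and all d.  It has to halt on every distance
   function, leaving its answer (1 for yes, 0 for no) in integer cell 0. *)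
Definition decides (p : cmd)
    (K : forall n : nat, ('I_n -> 'I_n -> R) -> Prop) : Prop :=
  forall (n : nat) (d : 'I_n -> 'I_n -> R), is_distance d ->
    exists (st : state) (answer : bool),
      [/\ exec p (input d) st, nmem st 0 = nat_of_bool answer
        & answer <-> K n d].

End Semantics.

(* Main.v *)
Require Import Defs.
From HB Require Import structures.
From mathcomp Require Import all_boot all_order all_algebra.
From mathcomp Require Import reals.
From mathcomp Require Import zify lra.

Set Implicit Arguments.
Unset Strict Implicit.
Unset Printing Implicit Defensive.

Import Order.TTheory GRing.Theory Num.Theory.
Local Open Scope ring_scope.

(* Up to scaling and sign, both families of inequalities say that a quadratic
   form G on Z^n with G(e_i) = kappa for all i satisfies G >= kappa on an affine
   set S of integer vectors (sum 1, resp. odd sum).  It suffices to check the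
   vectors of S in a box of computable radius, which a program can enumerate.
   Indeed, let b in S violate the inequality, with M = |b|_oo minimal and large.
   By the pigeonhole principle there are a small t > 0 and an integer vector u
   such that every m_j = M u_j - t b_j is small compared with M; moreover u can
   be taken parallel to S.  Then e_j + u, e_j - u and b - u lie in S and have
   norm less than M, so that, B being the polar form of G, |2 B(e_j, u)| <= G(u)
   and 2 B(b, u) < G(u).  Since M u = t b + sum_j m_j e_j, this gives
   2 M G(u) < (t + sum_j |m_j|) G(u) <= 2 M G(u), a contradiction. *)

(** * Reduction to a box *)

(** Dirichlet's pigeonhole: among the [k ^ n + 1] multiples [t * b] with [t <= k ^ n], two have
    residues modulo [M] in the same one of [k ^ n] boxes of side [M / k]. *)
Lemma simultaneous_approximation n (k M : nat) (b : 'I_n -> int) :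
  (0 < k)%N -> (0 < M)%N ->
  exists (u : 'I_n -> int) (t : nat), (0 < t <= k ^ n)%N /\
    forall j, k%:Z * `|M%:Z * u j - t%:Z * b j| < M%:Z.
Proof.
move=> k_gt0 M_gt0.
pose r (t : nat) j := (t%:Z * b j %% M)%Z.
have r_ge0 t j : 0 <= r t j by apply: modz_ge0; lia.
have r_lt t j : r t j < M%:Z by apply: ltz_pmod; lia.
have box_lt t j : (`|r t j|%N * k %/ M < k)%N.
  rewrite ltn_divLR // mulnC ltn_pmul2l //.
  by have := r_lt t j; have := r_ge0 t j; lia.
pose f (t : 'I_(k ^ n).+1) := [ffun j : 'I_n => Ordinal (box_lt t j)].
have /injectivePn[x [y neq_xy eq_f]] : ~~ injectiveb f.
  apply/negP => /injectiveP/leq_card.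
  by rewrite card_ffun !card_ord ltnn.
wlog lt_xy : x y neq_xy eq_f / (x < y)%N.
  move=> W; case: (ltngtP x y) => [|lt_yx|/val_inj eq_xy]; first exact: W.
    by apply: (W y x) => //; rewrite eq_sym.
  by rewrite eq_xy eqxx in neq_xy.
(* Subtracting the quotients by [M] of the two colliding multiples leaves a difference of residues
   as the error. *)
exists (fun j => (y%:Z * b j %/ M)%Z - (x%:Z * b j %/ M)%Z), (y - x)%N.
split=> [|j]; first by have := ltn_ord y; lia.
have /ffunP/(_ j) := eq_f; rewrite !ffunE => /(congr1 val) /= eq_box.
have := divz_eq (y%:Z * b j) M; have := divz_eq (x%:Z * b j) M.
rewrite -/(r x j) -/(r y j) => def_x def_y.
have -> : M%:Z * ((y%:Z * b j %/ M)%Z - (x%:Z * b j %/ M)%Z)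
          - (y - x)%N%:Z * b j = r x j - r y j.
  move: def_x def_y; move: (divz _ _) (divz _ _) (r x j) (r y j) => p q v z.
  by rewrite -subzn 1?ltnW //; lia.
have := leq_divM (`|r x j| * k) M; have := leq_divM (`|r y j| * k) M.
have := ltn_ceil (`|r x j| * k) M_gt0; have := ltn_ceil (`|r y j| * k) M_gt0.
rewrite eq_box -(gez0_abs (r_ge0 x j)) -(gez0_abs (r_ge0 y j)) !absz_nat.
move: `|r x j|%N `|r y j|%N (_ %/ M)%N => p q z *.
by rewrite -[k%:Z]/(`|k%:Z|) -normrM mulrBr ltr_norml; lia.
Qed.

(** * Descent for a quadratic form on a set of integer vectors *)

Section QuadraticForm.
Variables (R : realType) (n : nat) (w : 'I_n -> 'I_n -> R).
Implicit Types b c u : 'I_n -> int.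

Definition bform b c : R := \sum_i \sum_j (b i)%:~R * (c j)%:~R * w i j.

Definition in_box (M : nat) b := forall j, `|b j| <= M%:Z.

Definition basis_vector (i : 'I_n) : 'I_n -> int := fun j => (j == i)%:Z.

Lemma bformC b c : (forall i j, w i j = w j i) -> bform b c = bform c b.
Proof.
move=> w_sym; rewrite /bform exchange_big; apply: eq_bigr => i _.
by apply: eq_bigr => j _; rewrite w_sym (mulrC (b _)%:~R).
Qed.

Lemma bform_linearl (a : int) b c u :
  bform (fun j => a * b j + c j) u = a%:~R * bform b u + bform c u.
Proof.
rewrite /bform mulr_sumr -big_split; apply: eq_bigr => i _.
rewrite mulr_sumr -big_split; apply: eq_bigr => j _ /=.
by rewrite intrD intrM; lra.
Qed.

Lemma bform_basisl i u : bform (basis_vector i) u = \sum_j (u j)%:~R * w i j.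
Proof.
rewrite /bform (bigD1 i) //= [X in _ + X]big1 ?addr0 => [|k /negPf ki].
  by apply: eq_bigr => j _; rewrite /basis_vector eqxx mul1r.
by rewrite big1 // => j _; rewrite /basis_vector ki !mul0r.
Qed.

Lemma bform_basis i : bform (basis_vector i) (basis_vector i) = w i i.
Proof.
rewrite bform_basisl (bigD1 i) //= big1 => [|k /negPf ki].
  by rewrite /basis_vector eqxx mul1r addr0.
by rewrite /basis_vector ki !mul0r.
Qed.

Lemma bform_basis_sum b u :
  bform b u = \sum_i (b i)%:~R * bform (basis_vector i) u.
Proof.
apply: eq_bigr => i _; rewrite bform_basisl mulr_sumr.
by apply: eq_bigr => j _; rewrite mulrA.
Qed.

Hypothesis w_sym : forall i j, w i j = w j i.

Lemma bform_sqr (a : int) b u : let x := fun j => a * u j + b j in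
  bform x x = a%:~R ^+ 2 * bform u u + a%:~R * (2 * bform b u) + bform b b.
Proof.
rewrite /= bform_linearl (bformC u) // (bformC b) // !bform_linearl.
by rewrite (bformC u b) //; lra.
Qed.

(** One descent serves both families: [S] holds the vectors to be tested, [T] the directions along
    which [S] is stable, and [T_approx] asks for an approximation in such a direction. *)
Variables (kappa : R) (S T : ('I_n -> int) -> Prop) (A : nat).
Hypothesis w_diag : forall i, w i i = kappa.
Hypothesis S_basis : forall i, S (basis_vector i).
Hypothesis S_translate : forall b u (a : int),
  S b -> T u -> S (fun j => a * u j + b j).
Hypothesis T_approx : forall (M : nat) b, (A < M)%N -> S b -> in_box M b ->
  exists u (t : nat), [/\ T u, (0 < t)%N, (t.+1 < M)%N,
    forall j, `|M%:Z * u j - t%:Z * b j| < M%:Z &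
    t%:Z + \sum_j `|M%:Z * u j - t%:Z * b j| <= 2 * M%:Z].

Lemma box_step M : (A <= M)%N ->
    (forall b, S b -> in_box M b -> kappa <= bform b b) ->
  forall b, S b -> in_box M.+1 b -> kappa <= bform b b.
Proof.
move=> le_AM IH b Sb box_b; rewrite leNgt; apply/negP => lt_b.
have [u [t [Tu t_gt0 t_lt near_u sum_u]]] :=
  T_approx (M := M.+1) le_AM Sb box_b.
(* Since [t + 1 <= M], this keeps the basis vectors translated by [u] or [- u] in the smaller
   box. *)
have u_le j : `|u j| <= t.
  by have := near_u j; have := box_b j; nia.
have bu_le j : `|b j - u j| <= M.
  have := near_u j; have := box_b j; move: t_gt0 t_lt.
  set m := _ - _ => t_gt0 t_lt hb hm.
  (* The identity bounds the coordinate by [M.+1 - t], and [t] is positive. *)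
  have e : M.+1%:Z * (b j - u j) = (M.+1%:Z - t%:Z) * b j - m by rewrite /m; lia.
  nia.
have G_basis i (a : int) : `|a| = 1 ->
    a%:~R * (2 * bform (basis_vector i) u) + bform u u >= 0.
  move=> a1; have := IH _ (S_translate a (S_basis i) Tu).
  rewrite bform_sqr bform_basis w_diag -rmorphXn /=.
  have -> : a ^+ 2 = 1 by nia.
  move=> /(_ _)/[!mul1r] H.
  have : kappa <= bform u u + a%:~R * (2 * bform (basis_vector i) u) + kappa.
    by apply: H => j; rewrite /basis_vector; have := u_le j; case: (j == i); nia.
  lra.
have G_b : 2 * bform b u < bform u u.
  have := IH _ (S_translate (-1) Sb Tu).
  rewrite bform_sqr -rmorphXn /= sqrrN expr1n mul1r.
  have H : in_box M (fun j => -1 * u j + b j).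
    by move=> j; have := bu_le j; lia.
  move=> /(_ H); rewrite mulN1r; move: lt_b; lra.
have abs_basis i : `|2 * bform (basis_vector i) u| <= bform u u.
  have := G_basis i 1 erefl; have := G_basis i (-1) erefl.
  by rewrite ler_norml; lra.
have G_u : 0 <= bform u u.
  (* Any index gives the sign through [abs_basis]; for [n = 0] the form is an empty sum. *)
  case: (pickP 'I_n) => [i _|no_i]; first exact: le_trans (abs_basis i).
  by rewrite /bform big1 // => i; have := no_i i.
pose m j := M.+1%:Z * u j - t%:Z * b j.
have decomp : M.+1%:Z%:~R * bform u u = t%:Z%:~R * bform b u + bform m u.
  rewrite -bform_linearl; have := bform_linearl M.+1%:Z u (fun=> 0) u.
  have -> : bform (fun=> 0) u = 0.
    by rewrite /bform big1 // => i _; rewrite big1 // => j _; rewrite !mul0r.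
  rewrite addr0 => <-.
  by apply: eq_bigr => i _; apply: eq_bigr => j _; rewrite /m addr0 addrC subrK.
have le_m : 2 * bform m u <= (\sum_j `|m j|)%:~R * bform u u.
  rewrite bform_basis_sum mulr_sumr rmorph_sum mulr_suml; apply: ler_sum => i _ /=.
  rewrite mulrCA (le_trans (ler_norm _)) // normrM intr_norm.
  by rewrite ler_wpM2l.
have lt_t : t%:Z%:~R * (2 * bform b u) < t%:Z%:~R * bform u u.
  by rewrite ltr_pM2l ?ltr0z.
have : (t%:Z + \sum_j `|m j|)%:~R * bform u u <= (2 * M.+1%:Z)%:~R * bform u u.
  by rewrite ler_wpM2r // ler_int.
rewrite intrD intrM mulrDl -mulrA.
move: decomp le_m lt_t; rewrite mulrCA; lra.
Qed.

(** Growing the radius one unit at a time from [A] reaches every integer vector. *)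
Lemma box_bound : (forall b, S b -> in_box A b -> kappa <= bform b b) ->
  forall b, S b -> kappa <= bform b b.
Proof.
move=> HA b Sb.
have HM k : forall c, S c -> in_box (k + A) c -> kappa <= bform c c.
  by elim: k => // k; apply: box_step; rewrite leq_addl.
apply: (HM (\sum_j `|b j|)%N) => // j.
by rewrite (bigD1 j) //=; lia.
Qed.

End QuadraticForm.

(** The power bounds the multiplier [t] obtained for [k = 2 * n + 2], so any larger [M] exceeds
    [2 * t + 2]. *)
Definition box_radius (n : nat) : nat := (2 * (2 * n + 2) ^ n + 2)%N.

(** These bounds are sharper than [T_approx] asks: the last one forces [u] to have sum 0 when [b]
    has sum 1, and the factor 2 lets [u] and [t] be doubled when [b] has odd sum. *)
Lemma box_approximation n (M : nat) (b : 'I_n -> int) : (box_radius n < M)%N ->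
  exists (u : 'I_n -> int) (t : nat), [/\ (0 < t)%N, ((2 * t).+1 < M)%N,
    forall j, 2 * `|M%:Z * u j - t%:Z * b j| < M%:Z &
    t%:Z + \sum_j `|M%:Z * u j - t%:Z * b j| < M%:Z].
Proof.
rewrite /box_radius => lt_M.
have [||u [t [t_bd near_u]]] := @simultaneous_approximation n (2 * n + 2) M b; try lia.
exists u, t; split=> [||j|]; try lia.
  by have := near_u j; nia.
(* The errors thus add up to less than [M / 2], and [t] is below [M / 2] as well. *)
have : (2 * n + 2)%:Z * (\sum_j `|M%:Z * u j - t%:Z * b j|) <= n%:Z * M%:Z.
  have -> : n%:Z * M%:Z = \sum_(j < n) M%:Z.
    by rewrite sumr_const card_ord -mulr_natl natz.
  by rewrite mulr_sumr; apply: ler_sum => j _; rewrite ltW.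
have : 0 <= \sum_j `|M%:Z * u j - t%:Z * b j| by apply: sumr_ge0.
set s := \sum_j _; nia.
Qed.

(** * The two families of inequalities as quadratic forms *)

Section Bounds.
Variables (R : realType) (n : nat) (d : 'I_n -> 'I_n -> R).
Hypothesis d_dist : is_distance d.
Implicit Types b : 'I_n -> int.

Lemma bform_hyp_form b : bform d b b = 2 * hyp_form b d.
Proof.
have [d_sym d_diag] := d_dist.
rewrite /bform /hyp_form mulr_natl mulr2n.
have tri i j : (b i)%:~R * (b j)%:~R * d i j =
  (if (i < j)%N then (b i)%:~R * (b j)%:~R * d i j else 0)
  + (if (j < i)%N then (b i)%:~R * (b j)%:~R * d i j else 0).
  case: (ltngtP i j) => [||/val_inj->]; rewrite ?addr0 ?add0r //.
  by rewrite d_diag mulr0.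
under eq_bigr do under eq_bigr do rewrite tri.
under eq_bigr do rewrite big_split -!big_mkcond /=.
rewrite big_split /=; congr (_ + _).
under eq_bigr do rewrite big_mkcond.
rewrite exchange_big; apply: eq_bigr => j _; rewrite -big_mkcond.
by apply: eq_bigr => i _; rewrite d_sym (mulrC (b _)%:~R).
Qed.

Lemma sum_basis_vector (i : 'I_n) : \sum_j basis_vector i j = 1.
Proof.
by rewrite (bigD1 i) //= big1 ?addr0 /basis_vector ?eqxx // => j /negPf ->.
Qed.

Lemma sum_translate (a : int) (u b : 'I_n -> int) :
  \sum_j (a * u j + b j) = a * \sum_j u j + \sum_j b j.
Proof. by rewrite big_split mulr_sumr. Qed.

(** The descent is applied to the matrix [- d], whose zero diagonal gives [kappa = 0]; the
    directions are the vectors of sum 0. *)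
Lemma HYP_box :
  (forall b, in_box (box_radius n) b -> \sum_j b j = 1 -> bform d b b <= 0) <->
  HYP d.
Proof.
have [d_sym d_diag] := d_dist.
have bformN b : bform (fun i j => - d i j) b b = - bform d b b.
  rewrite -sumrN; apply: eq_bigr => i _; rewrite -sumrN.
  by apply: eq_bigr => j _; rewrite mulrN.
split=> [H|[_ H] b _ /H]; last by rewrite bform_hyp_form; lra.
split=> // b sum_b.
suff: 0 <= bform (fun i j => - d i j) b b by rewrite bformN bform_hyp_form; lra.
apply: (@box_bound _ _ _ _ 0 (fun b => \sum_j b j = 1) (fun u => \sum_j u j = 0)
  (box_radius n)) => //.
- by move=> i j; rewrite d_sym.
- by move=> i; rewrite d_diag oppr0.
- exact: sum_basis_vector.
- by move=> c u a Sc Tu; rewrite sum_translate Sc Tu mulr0.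
- move=> M c lt_M Sc box_c.
  have [u [t [t0 t1 nu su]]] := box_approximation c lt_M.
  exists u, t; split=> //; try lia.
  (* The right side is smaller than [M] in absolute value, so the integer sum of [u] vanishes. *)
  + have e : M%:Z * (\sum_j u j) = t%:Z + \sum_j (M%:Z * u j - t%:Z * c j).
      by rewrite sumrB -!mulr_sumr Sc mulr1 addrC subrK.
    have := ler_norm_sum (index_enum _) (fun j => M%:Z * u j - t%:Z * c j) xpredT.
    by move: su e; set s := \sum_j `|_|; set s' := \sum_j (_ - _); nia.
  + by move=> j; have := nu j; lia.
- by move=> c Sc box_c; rewrite bformN oppr_ge0; apply: H.
Qed.

Definition odd_sum b := exists s : int, \sum_j b j = 2 * s + 1.

(** For sum [2 * s + 1], four times [s * (s + 1)] is the squared sum minus 1. This removes [s] and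
    makes the condition homogeneous: the form with matrix [1 - 2 * d] has diagonal 1, hence
    [kappa = 1]. *)
Lemma HYPP_box :
  (forall b, in_box (box_radius n) b -> odd_sum b ->
     2 * bform d b b + 1 <= (\sum_j b j)%:~R ^+ 2) <-> HYPP d.
Proof.
have [d_sym d_diag] := d_dist.
have bformE b : bform (fun i j => 1 - 2 * d i j) b b
    = (\sum_j b j)%:~R ^+ 2 - 2 * bform d b b.
  rewrite expr2 rmorph_sum mulr_suml mulr_sumr -sumrB; apply: eq_bigr => i _.
  rewrite !mulr_sumr -sumrB; apply: eq_bigr => j _ /=; lra.
have odd_sqr (s : int) : ((2 * s + 1)%:~R ^+ 2 : R) = 4 * (s * (s + 1))%:~R + 1.
  by rewrite !(intrD, intrM); lra.
split=> [H|[_ H] b _ [s sum_b]]; last first.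
  by have := H b s sum_b; rewrite bform_hyp_form sum_b odd_sqr; lra.
split=> // b s sum_b.
suff: 1 <= bform (fun i j => 1 - 2 * d i j) b b.
  by rewrite bformE bform_hyp_form sum_b odd_sqr; lra.
apply: (@box_bound _ _ _ _ 1 odd_sum (fun u => exists s, \sum_j u j = 2 * s)
  (box_radius n)) => //.
- by move=> i j; rewrite d_sym.
- by move=> i; rewrite d_diag mulr0 subr0.
- by move=> i; exists 0; rewrite sum_basis_vector.
- move=> c u a [x Sc] [y Tu]; exists (a * y + x).
  by rewrite sum_translate Sc Tu; lia.
- move=> M c lt_M _ box_c.
  have [u [t [t0 t1 nu su]]] := box_approximation c lt_M.
  have e j : `|M%:Z * (2 * u j) - (2 * t)%N%:Z * c j|
             = 2 * `|M%:Z * u j - t%:Z * c j|.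
    by lia.
  (* Doubling makes the sum of the direction even, which preserves odd sums. *)
  exists (fun j => 2 * u j), (2 * t)%N; split=> //; try lia.
  + by exists (\sum_j u j); rewrite mulr_sumr.
  + by move=> j; rewrite e.
  + rewrite (eq_bigr _ (fun j _ => e j)) -mulr_sumr.
    by move: su; set s' := \sum_j _; lia.
- by move=> c odd_c box_c; rewrite bformE; have := H c box_c odd_c; lra.
- by exists s.
Qed.

End Bounds.

(** * The program and its correctness *)

Definition cell (a : nat) : nexp := NGet (NConst a).

Definition for_loop (i : nat) (bound : nexp) (body : cmd) : cmd :=
  Seq (NSet (NConst i) (NConst 0))
    (While (NLe (NAdd (cell i) (NConst 1)) bound)
       (Seq body (NSet (NConst i) (NAdd (cell i) (NConst 1))))).

(* Integer cells: 0 holds n, 1 the radius A of the box, 2 the base of the power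
   table, 3 the code c of the current vector b, 4 the answer so far, 5 the index
   of the inner loops, 6 the sum of the digits of c, and 7 + i, for i <= n, the
   i-th power of the base.  Real cell n * n accumulates the double sum of the
   b_i b_j d(i,j).  In base W = 2 A + 1, the digits of c are the A + b_i. *)
Definition power_cell (i : nexp) : nexp := NGet (NAdd (NConst 7) i).

Definition power_table : cmd :=
  Seq (NSet (NConst 7) (NConst 1))
    (for_loop 5 (cell 0)
       (NSet (NAdd (NConst 7) (NAdd (cell 5) (NConst 1)))
             (NMul (power_cell (cell 5)) (cell 2)))).

Definition digit_exp (i : nexp) : nexp :=
  NMod (NDiv (cell 3) (power_cell i)) (cell 2).

Definition coord_exp (i : nexp) : rexp :=
  RSub (RNat (digit_exp i)) (RNat (cell 1)).

(** As an address this is the first real cell after the input; as a number it bounds the loop over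
    all ordered pairs. *)
Definition form_cell : nexp := NMul (cell 0) (cell 0).

Definition check_code (fails : bexp) : cmd :=
  Seq (NSet (NConst 6) (NConst 0))
 (Seq (for_loop 5 (cell 0)
         (NSet (NConst 6) (NAdd (cell 6) (digit_exp (cell 5)))))
 (Seq (RSet form_cell (RNat (NConst 0)))
 (Seq (for_loop 5 form_cell
         (RSet form_cell
            (RAdd (RGet form_cell)
               (RMul (RMul (coord_exp (NDiv (cell 5) (cell 0)))
                           (coord_exp (NMod (cell 5) (cell 0))))
                     (RGet (cell 5))))))
      (If fails (NSet (NConst 4) (NConst 0)) Skip)))).

(** Expressions have no exponentiation, so the power table is filled twice: in base [2 * n + 2] to
    compute the radius, then in base [2 * A + 1] to decode vectors. Its last entry then counts the
    codes. *)
Definition search (fails : bexp) : cmd :=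
  Seq (NSet (NConst 2) (NAdd (NMul (NConst 2) (cell 0)) (NConst 2)))
 (Seq power_table
 (Seq (NSet (NConst 1)
        (NAdd (NMul (NConst 2) (power_cell (cell 0))) (NConst 2)))
 (Seq (NSet (NConst 2) (NAdd (NMul (NConst 2) (cell 1)) (NConst 1)))
 (Seq power_table
 (Seq (NSet (NConst 4) (NConst 1))
 (Seq (for_loop 3 (power_cell (cell 0)) (check_code fails))
      (NSet (NConst 0) (cell 4)))))))).

(** * Program logic *)

Section Hoare.
Variable R : realType.
Local Notation state := (state R).
Implicit Types (P Q I : state -> Prop) (p q : cmd).

(** Total correctness: halting is part of the triple, as [decides] demands. *)
Definition triple P p Q :=
  forall st, P st -> exists st', exec p st st' /\ Q st'.

Lemma triple_weaken P P' Q p :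
  (forall st, P st -> P' st) -> triple P' p Q -> triple P p Q.
Proof. by move=> PP' H st /PP'/H. Qed.

Lemma triple_skip P : triple P Skip P.
Proof. by move=> st Pst; exists st; split=> //; constructor. Qed.

Lemma triple_seq P Q Q' p q :
  triple P p Q -> triple Q q Q' -> triple P (Seq p q) Q'.
Proof.
move=> Hp Hq st /Hp[st1 [E1 /Hq[st2 [E2 H2]]]].
by exists st2; split=> //; apply: exec_seq E1 E2.
Qed.

Lemma triple_nset P Q a e :
  (forall st, P st ->
     Q (State (update (nmem st) (neval st a) (neval st e)) (rmem st))) ->
  triple P (NSet a e) Q.
Proof. by move=> H st /H Qst; eexists; split; [apply: exec_nset|]. Qed.

Lemma triple_rset P Q a e :
  (forall st, P st ->
     Q (State (nmem st) (update (rmem st) (neval st a) (reval st e)))) ->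
  triple P (RSet a e) Q.
Proof. by move=> H st /H Qst; eexists; split; [apply: exec_rset|]. Qed.

Lemma triple_if P Q c p q :
  triple (fun st => P st /\ beval st c) p Q ->
  triple (fun st => P st /\ ~~ beval st c) q Q -> triple P (If c p q) Q.
Proof.
move=> Hp Hq st Pst; case: (boolP (beval st c)) => Hc.
  have [st' [E Q']] := Hp st (conj Pst Hc).
  by exists st'; split=> //; apply: exec_if; rewrite Hc.
have [st' [E Q']] := Hq st (conj Pst Hc).
by exists st'; split=> //; apply: exec_if; rewrite (negPf Hc).
Qed.

(** The bound is evaluated anew before each round, so the invariant must fix its value; it must also
    survive the loop's own writes to the counter cell. *)
Lemma triple_for (I : nat -> state -> Prop) i bound body m :
  (forall k st, I k st -> neval st bound = m) ->
  (forall k st v, I k st -> I k (State (update (nmem st) i v) (rmem st))) ->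
  (forall k, (k < m)%N -> triple (fun st => I k st /\ nmem st i = k) body
                                 (fun st => I k.+1 st /\ nmem st i = k)) ->
  triple (I 0) (for_loop i bound body) (I m).
Proof.
move=> I_bound I_indep I_body; apply: (triple_seq (Q := fun st =>
    [/\ I 0 st, nmem st i = 0 & 0 <= m]%N)).
  apply: triple_nset => st /= Ist; split=> //; first exact: I_indep.
  by rewrite /update eqxx.
suff loop k j st : (j + k)%N = m -> I j st -> nmem st i = j ->
    exists st', exec (While (NLe (NAdd (cell i) (NConst 1)) bound)
       (Seq body (NSet (NConst i) (NAdd (cell i) (NConst 1))))) st st' /\ I m st'.
  by move=> st [Ist st_i _]; apply: (loop m 0 st).
elim: k j st => [|k IH] j st jk Ij st_i.
  exists st; split; last by rewrite -jk addn0.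
  by apply: exec_while_end; rewrite /= st_i (I_bound _ _ Ij); lia.
have [|st1 [E1 [I1 st1_i]]] := I_body j _ st (conj Ij st_i); first by lia.
pose st2 := State (update (nmem st1) i j.+1) (rmem st1).
have [|||st3 [E3 I3]] := IH j.+1 st2; rewrite ?addSnnS //.
- exact: I_indep.
- by rewrite /= /update eqxx.
exists st3; split=> //; apply: exec_while_loop E3.
  by rewrite /= st_i (I_bound _ _ Ij); lia.
apply: exec_seq E1 _; have -> : st2 = State
    (update (nmem st1) (neval st1 (NConst i))
       (neval st1 (NAdd (cell i) (NConst 1)))) (rmem st1).
  by rewrite /= st1_i addn1.
exact: exec_nset.
Qed.

End Hoare.

Definition digit (W c i : nat) : nat := (c %/ W ^ i %% W)%N.

Lemma digits_surj (W n : nat) (f : nat -> nat) : (forall i, f i < W)%N ->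
  exists2 c, (c < W ^ n)%N & forall i, (i < n)%N -> digit W c i = f i.
Proof.
move=> f_lt; have W_gt0 : (0 < W)%N by apply: leq_ltn_trans (f_lt 0).
elim: n => [|n [c c_lt c_dig]]; first by exists 0.
exists (f n * W ^ n + c)%N => [|i].
  rewrite expnS; have := leq_mul (f_lt n) (leqnn (W ^ n)); lia.
rewrite ltnS leq_eqVlt => /orP[/eqP->|lt_in].
  by rewrite /digit divnMDl ?expn_gt0 ?W_gt0 // divn_small // addn0 modn_small.
(* The new leading term is a multiple of [W ^ i.+1], so it leaves digit [i] unchanged. *)
have -> : (f n * W ^ n + c = f n * W ^ (n - i.+1) * W * W ^ i + c)%N.
  by congr addn; rewrite -!mulnA -expnS -expnD; congr (_ * W ^ _)%N; lia.
by rewrite -(c_dig i lt_in) /digit divnMDl ?expn_gt0 ?W_gt0 // -modnDml modnMl add0n.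
Qed.

(** * Correctness of the exhaustive search *)

Section Search.
Variable R : realType.
Local Notation state := (state R).
Variables (n : nat) (D : nat -> R).

Definition distances_kept (st : state) :=
  forall k, (k < n * n)%N -> rmem st k = D k.

Definition power_pre a w (st : state) :=
  [/\ nmem st 0 = n, nmem st 1 = a, nmem st 2 = w & distances_kept st].

Definition powers w m (st : state) :=
  forall i, (i <= m)%N -> nmem st (7 + i) = (w ^ i)%N.

Lemma power_table_correct a w : triple (power_pre a w) power_table
  (fun st => power_pre a w st /\ powers w n st).
Proof.
apply: (triple_seq (Q := fun st => power_pre a w st /\ powers w 0 st)).
  apply: triple_nset => st [st0 st1 st2 stD]; split=> //.
  by case.
apply: (triple_for (I := fun k st => power_pre a w st /\ powers w k st)).
- by move=> k st [[]].
- by move=> k st v [[st0 st1 st2 stD] stw].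
move=> k lt_kn; apply: triple_nset => st [[[st0 st1 st2 stD] stw] st5].
split=> //; split=> // i le_i; rewrite /update /= st5.
have -> : (7 + i == 7 + (k + 1))%N = (i == k.+1) by lia.
case: eqP => [->|neq_i]; first by rewrite stw // st2 expnSr.
by rewrite stw //; lia.
Qed.

(** [bad] is the meaning of the test [fails], as a function of [n], the radius, the digit sum and
    the value of the form. *)
Variables (fails : bexp) (bad : nat -> nat -> nat -> R -> bool).
Hypothesis failsE : forall st : state, beval st fails =
  bad (nmem st 0) (nmem st 1) (nmem st 6) (rmem st (nmem st 0 * nmem st 0)%N).
Variables (A W : nat).

Definition search_env (c : nat) (ok : bool) (st : state) :=
  [/\ power_pre A W st, powers W n st, nmem st 3 = c & nmem st 4 = ok].

Lemma search_env_update_form c ok st v : search_env c ok st ->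
  search_env c ok
    (State (nmem st) (update (rmem st) (nmem st 0 * nmem st 0)%N v)).
Proof.
move=> [[st0 ? ? stD] ? ? ?]; split=> //; split=> // k lt_k.
by rewrite /update /= st0 ltn_eqF // stD.
Qed.

Definition digit_sum c := (\sum_(i < n) digit W c i)%N.

Definition coord c i : R := (digit W c i)%:R - A%:R.

Definition code_form c :=
  \sum_(0 <= k < n * n) coord c (k %/ n) * coord c (k %% n) * D k.

Definition no_bad m :=
  all (fun c => ~~ bad n A (digit_sum c) (code_form c)) (iota 0 m).

Lemma check_code_correct c ok : triple (search_env c ok) (check_code fails)
  (search_env c (ok && ~~ bad n A (digit_sum c) (code_form c))).
Proof.
apply: (triple_seq (Q := fun st => search_env c ok st /\
    nmem st 6 = \sum_(i < 0) digit W c i)%N).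
  apply: triple_nset => st [[? ? ? ?] ? ? ?]; split=> //=.
  by rewrite big_ord0.
apply: (triple_seq (Q := fun st => search_env c ok st /\
    nmem st 6 = \sum_(i < n) digit W c i)%N).
  apply: (triple_for (I := fun k st => search_env c ok st /\
      nmem st 6 = \sum_(i < k) digit W c i)%N).
  - by move=> k st [[[]]].
  - by move=> k st v [[[? ? ? ?] ? ? ?] ?].
  move=> k lt_kn; apply: triple_nset.
  move=> st [[[[? ? st2 ?] stw st3 ?] st6] st5]; split=> //=.
  by rewrite /update /= st6 st5 st3 st2 stw 1?ltnW // big_ord_recr.
apply: (triple_seq (Q := fun st => (search_env c ok st /\
    nmem st 6 = digit_sum c) /\ rmem st (n * n) =
    \sum_(0 <= k < 0) coord c (k %/ n) * coord c (k %% n) * D k)).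
  apply: triple_rset => st [st_env ?].
  split; first by split=> //; apply: search_env_update_form.
  by case: st_env => [[st0]] *; rewrite /= /update st0 eqxx big_geq.
apply: (triple_seq (Q := fun st => (search_env c ok st /\
    nmem st 6 = digit_sum c) /\ rmem st (n * n) = code_form c)).
  (* In the invariant, the upper limit of the sum is the loop counter, whose name the summation
     index reuses. *)
  apply: (triple_for (I := fun k st => (search_env c ok st /\
      nmem st 6 = digit_sum c) /\ rmem st (n * n) =
      \sum_(0 <= k < k) coord c (k %/ n) * coord c (k %% n) * D k)).
  - by move=> k st [[[[/= ->]]]].
  - by move=> k st v [[[[? ? ? ?] ? ? ?] ?] ?].
  move=> k lt_k; have n_gt0 : (0 < n)%N by case: (n) lt_k.
  apply: triple_rset => st [[[st_env ?] stF] st5].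
  split=> //; split; first by split=> //; apply: search_env_update_form.
  case: st_env => [[st0 st1 st2 stD] stw st3 _].
  rewrite /= /update st0 eqxx stF st5 st3 st2 st1 stD // !stw.
  - by rewrite big_nat_recr.
  - by rewrite ltnW // ltn_mod.
  - by rewrite ltnW // ltn_divLR.
apply: triple_if.
  apply: triple_nset => st [[[[[st0 st1 st2 ?] ? ? st4] st6] stF]].
  by rewrite failsE st0 st1 st6 stF => ->; rewrite andbF.
apply: triple_weaken (@triple_skip _ _).
move=> st [[[[[st0 st1 st2 ?] ? ? st4] st6] stF]].
by rewrite failsE st0 st1 st6 stF => ->; rewrite andbT.
Qed.

Lemma search_loop_correct : triple
  (fun st => [/\ power_pre A W st, powers W n st & nmem st 4 = 1%N])
  (for_loop 3 (power_cell (cell 0)) (check_code fails))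
  (fun st => nmem st 4 = no_bad (W ^ n)).
Proof.
apply: (triple_weaken (P' := fun st =>
  [/\ power_pre A W st, powers W n st & nmem st 4 = no_bad 0])) => //.
have H : triple (fun st =>
  [/\ power_pre A W st, powers W n st & nmem st 4 = no_bad 0])
  (for_loop 3 (power_cell (cell 0)) (check_code fails)) (fun st =>
  [/\ power_pre A W st, powers W n st & nmem st 4 = no_bad (W ^ n)]).
  apply: (triple_for (I := fun c st =>
    [/\ power_pre A W st, powers W n st & nmem st 4 = no_bad c])).
  - by move=> c st [[/= -> _ _ _] ->].
  - by move=> c st v [[? ? ? ?] ? ?].
  move=> c _; apply: (triple_weaken (P' := search_env c (no_bad c))).
    by move=> st [[? ? ?] ?].
  move=> st /check_code_correct[st' [E [? ? ? st4]]].
  exists st'; split=> //; split=> //.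
  by rewrite st4 /no_bad -[in RHS]addn1 iotaD all_cat /= add0n andbT.
by move=> st /H[st' [E []]]; exists st'.
Qed.

End Search.

Lemma search_correct (R : realType) n (D : nat -> R) fails bad
  (A := box_radius n) (W := (2 * A + 1)%N) :
  (forall st : state R, beval st fails = bad (nmem st 0) (nmem st 1)
      (nmem st 6) (rmem st (nmem st 0 * nmem st 0)%N)) ->
  triple (fun st => nmem st 0 = n /\ distances_kept n D st) (search fails)
    (fun st => nmem st 0 = no_bad n D bad A W (W ^ n)).
Proof.
move=> failsE.
apply: (triple_seq (Q := fun st => power_pre n D (nmem st 1) (2 * n + 2) st)).
  by apply: triple_nset => st [st0 ?]; split=> //; rewrite /= /update st0.
(* The radius is not computed yet, so the content of cell 1 is left existential. *)
apply: (triple_seq (Q := fun st =>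
    exists a, power_pre n D a (2 * n + 2) st /\ powers (2 * n + 2) n st)).
  move=> st /power_table_correct[st' [E H]].
  by exists st'; split=> //; exists (nmem st 1).
apply: (triple_seq (Q := power_pre n D A (2 * n + 2))).
  apply: triple_nset => st [a [[st0 st1 st2 ?] stw]].
  by split=> //=; rewrite /update /= st0 stw.
apply: (triple_seq (Q := power_pre n D A W)).
  apply: triple_nset => st [st0 st1 st2 ?].
  by split=> //=; rewrite /update /= st1.
apply: triple_seq; first exact: power_table_correct.
apply: (triple_seq (Q := fun st =>
    [/\ power_pre n D A W st, powers W n st & nmem st 4 = 1%N])).
  by apply: triple_nset => st [[? ? ? ?] ?].
apply: triple_seq; first exact: (@search_loop_correct _ _ _ _ _ failsE).
by apply: triple_nset => st /=.
Qed.

(** * From codes to vectors of the box *)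

Lemma code_form_bform (R : realType) n (d : 'I_n -> 'I_n -> R) A W c
    (b : 'I_n -> int) : (forall i : 'I_n, (digit W c i)%:Z = b i + A%:Z) ->
  code_form n (rmem (input d)) A W c = bform d b b.
Proof.
move=> bE; have coordE (i : 'I_n) : coord R A W c i = (b i)%:~R.
  by rewrite /coord -[b i](addrK A%:Z) -bE intrD intrN.
(* The range below [n * n] is cut into [n] blocks of length [n], the rows of [d]. *)
rewrite /code_form big_nat_mul big_mkord; apply: eq_bigr => i _.
rewrite -{1}[(i * n)%N]add0n mulSn big_addn addnK big_mkord.
apply: eq_bigr => j _; have n_gt0 : (0 < n)%N by case: (n) i => [[]|].
rewrite addnC divnMDl // divn_small // addn0 modnMDl modn_small //.
by rewrite input_rmem !coordE.
Qed.

(** Coordinates between [- A] and [A], shifted by [A], are exactly the digits in base [2 * A + 1],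
    so running through the codes runs through the box. The shift adds [n * A] to the sum. *)
Lemma search_decides (R : realType) (fails : bexp)
    (bad : nat -> nat -> nat -> R -> bool)
    (K : forall n, ('I_n -> 'I_n -> R) -> Prop)
    (good : forall n, ('I_n -> 'I_n -> R) -> ('I_n -> int) -> Prop) :
  (forall st : state R, beval st fails = bad (nmem st 0) (nmem st 1)
      (nmem st 6) (rmem st (nmem st 0 * nmem st 0)%N)) ->
  (forall n (d : 'I_n -> 'I_n -> R) (b : 'I_n -> int) A S,
     S%:Z = \sum_i b i + (n * A)%:Z ->
     ~~ bad n A S (bform d b b) <-> good n d b) ->
  (forall n (d : 'I_n -> 'I_n -> R), is_distance d ->
     (forall b, in_box (box_radius n) b -> good n d b) <-> K n d) ->
  decides (search fails) K.
Proof.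
move=> failsE badE boxE n d d_dist.
pose A := box_radius n; pose W := (2 * A + 1)%N.
have [//|st [E st0]] := @search_correct R n (rmem (input d)) _ _ failsE (input d).
exists st, (no_bad n (rmem (input d)) bad A W (W ^ n)); split=> //.
apply: iff_trans (boxE n d d_dist); rewrite -/A.
have codeE c (b : 'I_n -> int) :
    (forall i : 'I_n, (digit W c i)%:Z = b i + A%:Z) ->
    ~~ bad n A (digit_sum n W c) (code_form n (rmem (input d)) A W c) <->
    good n d b.
  move=> bE; rewrite (code_form_bform _ bE); apply: badE.
  rewrite /digit_sum (big_morph Posz PoszD (erefl _)); under eq_bigr do rewrite bE.
  by rewrite big_split sumr_const card_ord -mulr_natl natz.
have W_gt0 : (0 < W)%N by rewrite /W addn1.
split=> [/allP H b box_b|H].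
  (* Every vector of the box has a code; its digit function is extended by 0 to all naturals. *)
  pose f i := if insub i is Some j then absz (b j + A%:Z) else 0%N.
  have f_lt i : (f i < W)%N.
    rewrite /f; case: insubP => // j _ _; have := box_b j; rewrite /W; lia.
  have [c c_lt c_dig] := digits_surj n f_lt.
  have bE (i : 'I_n) : (digit W c i)%:Z = b i + A%:Z.
    by rewrite c_dig // /f valK; have := box_b i; lia.
  by apply/(codeE c b bE)/H; rewrite mem_iota.
(* Conversely, every code decodes to a vector of the box. *)
apply/allP => c _; apply/(codeE c (fun i : 'I_n => (digit W c i)%:Z - A%:Z)).
  by move=> i; rewrite subrK.
apply: H => i; have : (digit W c i < W)%N by rewrite ltn_mod.
by rewrite /W; lia.
Qed.

(** Sum 1 means digit sum [1 + n * A]; the equality is tested by two comparisons. *)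
Definition HYP_fails : bexp :=
  let t := NAdd (NConst 1) (NMul (cell 0) (cell 1)) in
  BAnd (BAnd (NLe (cell 6) t) (NLe t (cell 6)))
       (BNot (RLe (RGet form_cell) (RNat (NConst 0)))).

(** Subtraction on naturals truncates, so parity is read off the digit sum plus [n * A], and the
    true sum is computed among the reals. *)
Definition HYPP_fails : bexp :=
  let t := NMul (cell 0) (cell 1) in
  let sum := RSub (RNat (cell 6)) (RNat t) in
  BAnd (NLe (NConst 1) (NMod (NAdd (cell 6) t) (NConst 2)))
       (BNot (RLe (RAdd (RMul (RNat (NConst 2)) (RGet form_cell)) (RNat (NConst 1)))
                  (RMul sum sum))).

Theorem theorem3 (R : realType) :
  (exists p : cmd, decides p (@HYP R)) /\
  (exists p : cmd, decides p (@HYPP R)).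
Proof.
split.
  exists (search HYP_fails).
  apply: (search_decides
    (bad := fun n A S x =>
      ((S <= 1 + n * A) && (1 + n * A <= S))%N && ~~ (x <= 0))
    (good := fun n d b => \sum_i b i = 1 -> bform d b b <= 0)) => //.
  - move=> n d b A S sumE; rewrite -eqn_leq negb_and negbK.
    split=> [/orP[neq|->//] sum_b|H].
      by rewrite sum_b in sumE; lia.
    by case: eqP => //= eS; apply: H; lia.
  - by move=> n d /HYP_box <-.
exists (search HYPP_fails).
apply: (search_decides
  (bad := fun n A S x => (1 <= (S + n * A) %% 2)%N &&
    ~~ (2 * x + 1 <= (S%:R - (n * A)%:R) * (S%:R - (n * A)%:R)))
  (good := fun n d b => odd_sum b ->
    2 * bform d b b + 1 <= (\sum_j b j)%:~R ^+ 2)) => //.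
- move=> n d b A S sumE; rewrite negb_and negbK.
  have -> : (S%:R - (n * A)%:R : R) = (\sum_j b j)%:~R.
    by rewrite -[\sum_j b j](addrK (n * A)%N%:Z) -sumE intrD intrN.
  rewrite -expr2; split=> [/orP[par|->//] [s sum_b]|H].
    by rewrite sum_b in sumE; lia.
  (* For an odd sum, the quotient by 2 is the required [s]. *)
  case: (boolP (0 < _)%N) => //= par; apply: H; exists ((\sum_i b i) %/ 2)%Z.
  by move: sumE; set s := \sum_i b i; lia.
- by move=> n d /HYPP_box <-.
Qed.
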